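(* Let $\alpha,\beta$ be generators, let $\mathbb C(N)$ be the associated field of $\ast$-complex numbers, let $\mathbb A$ and $\mathbb B$ be $\ast_N$-algebras, and let $\varphi_N:\mathbb A\to\mathbb B$ be a $\ast_N$-homomorphism. Then $Ker_N(\varphi_N)=\{x\in\mathbb A:\varphi_N(x)=0_{\mathbb B}^N\}$ is an $N$-self adjoint ideal of $\mathbb A$.
   Context: A generator is an injective function $\mathbb R\to\mathbb R$. For generators $\alpha,\beta$, write $\dot a=\alpha(a)$, $\ddot b=\beta(b)$ for $a,b\in\mathbb R$. $\mathbb C(N)=\{(\dot a,\ddot b):a,b\in\mathbb R\}$ is a field under $(\dot a_1,\ddot b_1)\oplus(\dot a_2,\ddot b_2)=(\alpha(a_1+a_2),\beta(b_1+b_2))$ and $(\dot a_1,\ddot b_1)\odot(\dot a_2,\ddot b_2)=(\alpha(a_1a_2-b_1b_2),\beta(a_1b_2+b_1a_2))$, with conjugation $\overline{(\dot a,\ddot b)}=(\dot a,\beta(-b))$. A $\mathbb C(N)$-algebra is a vector space $\mathbb A$ over the field $\mathbb C(N)$ (operations $\widehat+,\widehat\cdot$, zero $0_{\mathbb A}^N$) with an associative multiplication $\widehat\times$, distributive over $\widehat+$ on both sides, such that $\lambda\widehat\cdot(x\widehat\times y)=x\widehat\times(\lambda\widehat\cdot y)=(\lambda\widehat\cdot x)\widehat\times y$. A $\ast_N$-algebra is a $\mathbb C(N)$-algebra with an $N$-involution, i.e. a map $x\mapsto x^{\ast_N}$ with $(x\widehat+y)^{\ast_N}=x^{\ast_N}\widehat+y^{\ast_N}$,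 $(\lambda\widehat\cdot x)^{\ast_N}=\overline\lambda\,\widehat\cdot\,x^{\ast_N}$, $(x\widehat\times y)^{\ast_N}=y^{\ast_N}\widehat\times x^{\ast_N}$, $(x^{\ast_N})^{\ast_N}=x$. A $\mathbb C(N)$-algebra homomorphism is a map $\varphi_N:\mathbb A\to\mathbb B$ that is $\mathbb C(N)$-linear (it sends $x\widehat+\lambda\widehat\cdot y$ to the sum of $\varphi_N(x)$ and $\lambda$ times $\varphi_N(y)$ in $\mathbb B$) and multiplicative. It is a $\ast_N$-homomorphism if moreover $\varphi_N(x^{\ast_N})=\varphi_N(x)^{\ast_N}$ for all $x$. An $N$-subalgebra is a subset containing zero and closed under addition, scalar multiplication and multiplication. An $N$-ideal of $\mathbb A$ is an $N$-subalgebra $I$ with $x\widehat\times y\in I$ and $y\widehat\times x\in I$ for all $x\in\mathbb A$, $y\in I$. It is an $N$-self adjoint ideal if $I^{\ast_N}:=\{x^{\ast_N}:x\in I\}=I$. *)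

(* Defs.v *)
(* The real line is an arbitrary R : realType. *)
From HB Require Import structures.
From mathcomp Require Import all_boot all_order all_algebra.
From mathcomp Require Import boolp classical_sets reals ring.

Set Implicit Arguments.
Unset Strict Implicit.
Unset Printing Implicit Defensive.

Import Order.TTheory GRing.Theory Num.Theory.

Local Open Scope classical_set_scope.
Local Open Scope ring_scope.

Record generator (R : realType) := Generator {
  gen_fun :> R -> R;
  gen_inj : injective gen_fun }.

(* The carrier C(N) = {(alpha a, beta b) : a, b in R}, as a subtype of R * R. *)
Section StarComplex.
Context {R : realType} (alpha beta : generator R).

Definition CN_set : set (R * R) :=
  [set p | exists a b : R, p = (alpha a, beta b)].

Record CN := MkCN { CN_val : R * R; _ : `[< CN_set CN_val >] }.

HB.instance Definition _ := [isSub for CN_val].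
HB.instance Definition _ := [Choice of CN by <:].

Lemma CN_of_subproof (a b : R) : `[< CN_set (alpha a, beta b) >].
Proof. by apply/asboolP; exists a, b. Qed.

Definition CN_of (a b : R) : CN := MkCN (CN_of_subproof a b).

Lemma CN_of_surj (z : CN) : exists a b, z = CN_of a b.
Proof.
case: z => p hp; have /asboolP[a [b e]] := hp.
by exists a, b; apply: val_inj.
Qed.

(* The unique a and b such that z = (alpha a, beta b). *)
Definition CN_fst (z : CN) : R := sval (cid (CN_of_surj z)).
Definition CN_snd (z : CN) : R := sval (cid (svalP (cid (CN_of_surj z)))).

Lemma CN_ofK (z : CN) : CN_of (CN_fst z) (CN_snd z) = z.
Proof. exact/esym/(svalP (cid (svalP (cid (CN_of_surj z))))). Qed.

Lemma CN_of_inj (a b c d : R) : CN_of a b = CN_of c d -> a = c /\ b = d.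
Proof.
by move/(congr1 CN_val) => /= [] /(@gen_inj _ _ _ _) -> /(@gen_inj _ _ _ _) ->.
Qed.

Lemma CN_fstE (a b : R) : CN_fst (CN_of a b) = a.
Proof. by have [] := CN_of_inj (CN_ofK (CN_of a b)). Qed.

Lemma CN_sndE (a b : R) : CN_snd (CN_of a b) = b.
Proof. by have [] := CN_of_inj (CN_ofK (CN_of a b)). Qed.

Definition CN_add (z w : CN) : CN :=
  CN_of (CN_fst z + CN_fst w) (CN_snd z + CN_snd w).

Definition CN_opp (z : CN) : CN := CN_of (- CN_fst z) (- CN_snd z).

Definition CN_mul (z w : CN) : CN :=
  CN_of (CN_fst z * CN_fst w - CN_snd z * CN_snd w)
        (CN_fst z * CN_snd w + CN_snd z * CN_fst w).

Definition CN_conj (z : CN) : CN := CN_of (CN_fst z) (- CN_snd z).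

Definition CN_inv (z : CN) : CN :=
  let n := CN_fst z ^+ 2 + CN_snd z ^+ 2 in
  CN_of (CN_fst z / n) (- CN_snd z / n).

Let CN_E := (CN_fstE, CN_sndE).

Fact CN_addA : associative CN_add.
Proof. by move=> x y z; rewrite /CN_add !CN_E !addrA. Qed.

Fact CN_addC : commutative CN_add.
Proof. by move=> x y; congr CN_of; rewrite addrC. Qed.

Fact CN_add0 : left_id (CN_of 0 0) CN_add.
Proof. by move=> x; rewrite /CN_add !CN_E !add0r CN_ofK. Qed.

Fact CN_addN : left_inverse (CN_of 0 0) CN_opp CN_add.
Proof. by move=> x; rewrite /CN_add !CN_E !addNr. Qed.

HB.instance Definition _ :=
  GRing.isZmodule.Build CN CN_addA CN_addC CN_add0 CN_addN.

Fact CN_mulA : associative CN_mul.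
Proof.
by move=> x y z; rewrite /CN_mul !CN_E; congr CN_of; ring.
Qed.

Fact CN_mulC : commutative CN_mul.
Proof.
by move=> x y; rewrite /CN_mul; congr CN_of; ring.
Qed.

Fact CN_mul1 : left_id (CN_of 1 0) CN_mul.
Proof. by move=> x; rewrite /CN_mul !CN_E !mul1r !mul0r subr0 addr0 CN_ofK. Qed.

Fact CN_mulDl : left_distributive CN_mul CN_add.
Proof.
by move=> x y z; rewrite /CN_mul /CN_add !CN_E; congr CN_of; ring.
Qed.

Fact CN_one_neq0 : CN_of 1 0 != 0 :> CN.
Proof. by apply/eqP => /CN_of_inj[/eqP]; rewrite oner_eq0. Qed.

HB.instance Definition _ := GRing.Zmodule_isComNzRing.Build CN
  CN_mulA CN_mulC CN_mul1 CN_mulDl CN_one_neq0.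

Fact CN_mulV (z : CN) : z != 0 -> CN_inv z * z = 1.
Proof.
move=> z0; have n0 : CN_fst z ^+ 2 + CN_snd z ^+ 2 != 0.
  apply: contra_neq z0 => /eqP.
  rewrite paddr_eq0 ?sqr_ge0// !sqrf_eq0 => /andP[/eqP a0 /eqP b0].
  by rewrite -(CN_ofK z) a0 b0.
by rewrite /GRing.mul/= /CN_mul /CN_inv !CN_E; congr CN_of; field.
Qed.

Fact CN_inv0 : CN_inv 0 = 0.
Proof. by rewrite /CN_inv !CN_E oppr0 !mul0r. Qed.

HB.instance Definition _ := GRing.ComNzRing_isField.Build CN CN_mulV CN_inv0.

Lemma CN_addE (a1 b1 a2 b2 : R) :
  CN_of a1 b1 + CN_of a2 b2 = CN_of (a1 + a2) (b1 + b2).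
Proof. by rewrite /GRing.add/= /CN_add !CN_E. Qed.

Lemma CN_mulE (a1 b1 a2 b2 : R) :
  CN_of a1 b1 * CN_of a2 b2 = CN_of (a1 * a2 - b1 * b2) (a1 * b2 + b1 * a2).
Proof. by rewrite /GRing.mul/= /CN_mul !CN_E. Qed.

Lemma CN_conjE (a b : R) : CN_conj (CN_of a b) = CN_of a (- b).
Proof. by rewrite /CN_conj !CN_E. Qed.

End StarComplex.

(* The algebras are not assumed to be unital, so the multiplication is added on
   top of lmodType rather than taken from algType. *)
HB.mixin Record Lmodule_isCNAlgebra (R : realType) (alpha beta : generator R)
    A & GRing.Lmodule (CN alpha beta) A := {
  nmul : A -> A -> A;
  nmulA : associative nmul;
  nmulDl : left_distributive nmul +%R;
  nmulDr : right_distributive nmul +%R;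
  scalernAr : forall (l : CN alpha beta) x y, l *: nmul x y = nmul x (l *: y);
  scalernAl : forall (l : CN alpha beta) x y, l *: nmul x y = nmul (l *: x) y }.

#[short(type="cnAlgType")]
HB.structure Definition CNAlgebra (R : realType) (alpha beta : generator R) :=
  { A of GRing.Lmodule (CN alpha beta) A & Lmodule_isCNAlgebra R alpha beta A }.

HB.mixin Record CNAlgebra_hasStar (R : realType) (alpha beta : generator R)
    A & CNAlgebra R alpha beta A := {
  nstar : A -> A;
  nstarD : forall x y : A, nstar (x + y) = nstar x + nstar y;
  nstarZ : forall (l : CN alpha beta) (x : A),
    nstar (l *: x) = CN_conj l *: nstar x;
  nstarM : forall x y : A, nstar (nmul x y) = nmul (nstar y) (nstar x);
  nstarK : involutive nstar }.

#[short(type="starNAlgType")]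
HB.structure Definition StarNAlgebra (R : realType) (alpha beta : generator R) :=
  { A of CNAlgebra R alpha beta A & CNAlgebra_hasStar R alpha beta A }.

Section Morphisms.
Context {R : realType} {alpha beta : generator R}.

Definition CN_algebra_hom (A B : cnAlgType alpha beta) (phi : A -> B) : Prop :=
  linear phi /\ {morph phi : x y / nmul x y}.

Definition starN_hom (A B : starNAlgType alpha beta) (phi : A -> B) : Prop :=
  CN_algebra_hom phi /\ {morph phi : x / nstar x}.

Definition KerN (A B : cnAlgType alpha beta) (phi : A -> B) : set A :=
  [set x | phi x = 0].

End Morphisms.

Section Ideals.
Context {R : realType} {alpha beta : generator R}.

Definition N_subalgebra (A : cnAlgType alpha beta) (S : set A) : Prop :=
  [/\ S 0,
      forall x y, S x -> S y -> S (x + y),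
      forall (l : CN alpha beta) x, S x -> S (l *: x) &
      forall x y, S x -> S y -> S (nmul x y)].

Definition N_ideal (A : cnAlgType alpha beta) (I : set A) : Prop :=
  N_subalgebra I /\
  forall x y, I y -> I (nmul x y) /\ I (nmul y x).

Definition N_selfadjoint_ideal (A : starNAlgType alpha beta) (I : set A) :
    Prop :=
  N_ideal I /\ [set nstar x | x in I] = I.

End Ideals.

(* Main.v *)
Require Import Defs.
From mathcomp Require Import all_boot all_order all_algebra.
From mathcomp Require Import boolp classical_sets reals.

Section Kernel.
Import GRing.Theory.
Local Open Scope classical_set_scope.
Local Open Scope ring_scope.
Context {R : realType} {alpha beta : generator R}.

(** Everything reduces to how zero behaves in [B]: it is absorbed by sums and scalars, annihilates
    every product on both sides ([nmul0r], [nmulr0]), and is fixed by the star ([nstar0]). Pushing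
    [phi] through each operation then gives the ideal laws ([KerN_ideal]) and stability under the
    star; as the star is an involution, stability already forces equality ([KerN_nstar]). *)

Lemma nmul0r (A : cnAlgType alpha beta) (x : A) : nmul 0 x = 0.
Proof. by apply: (addrI (nmul 0 x)); rewrite -nmulDl !addr0. Qed.

Lemma nmulr0 (A : cnAlgType alpha beta) (x : A) : nmul x 0 = 0.
Proof. by apply: (addrI (nmul x 0)); rewrite -nmulDr !addr0. Qed.

Lemma nstar0 (A : starNAlgType alpha beta) : nstar 0 = 0 :> A.
Proof. by apply: (addrI (nstar 0)); rewrite -nstarD !addr0. Qed.

Lemma KerN_ideal (A B : cnAlgType alpha beta) (phi : A -> B) :
  CN_algebra_hom phi -> N_ideal (KerN phi).
Proof.
move=> [phi_lin phiM].
(* [linear] is the single law for [l *: x + y]: [l = 1] gives additivity, hence [phi 0 = 0] by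
   cancellation, and only then does [y = 0] give homogeneity. *)
have phiD x y : phi (x + y) = phi x + phi y.
  by have := phi_lin 1 x y; rewrite !scale1r.
have phi0 : phi 0 = 0 by apply: (addrI (phi 0)); rewrite -phiD !addr0.
have phiZ l x : phi (l *: x) = l *: phi x.
  by have := phi_lin l x 0; rewrite phi0 !addr0.
rewrite /KerN; split; first split => //=.
- by move=> x y x0 y0; rewrite phiD x0 y0 addr0.
- by move=> l x x0; rewrite phiZ x0 scaler0.
- by move=> x y x0 _; rewrite phiM x0 nmul0r.
- by move=> x y /= y0; rewrite !phiM y0 nmulr0 nmul0r.
Qed.

Lemma KerN_nstar (A B : starNAlgType alpha beta) (phi : A -> B) :
  {morph phi : x / nstar x} -> [set nstar x | x in KerN phi] = KerN phi.
Proof.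
move=> phi_star.
have ker_star x : KerN phi x -> KerN phi (nstar x).
  by rewrite /KerN /= phi_star => ->; rewrite nstar0.
apply/seteqP; split=> [_ [x /ker_star ? <-] //|x /ker_star kx].
(* A kernel element [x] is the star of [nstar x], which lies in the kernel by [kx]. *)
by exists (nstar x); rewrite ?nstarK.
Qed.

End Kernel.

Theorem theorem8 (R : realType) (alpha beta : generator R)
    (A B : starNAlgType alpha beta) (phi : A -> B) (hphi : starN_hom phi) :
  N_selfadjoint_ideal (KerN phi).
Proof.
by case: hphi => phi_hom phi_star; split; [apply: KerN_ideal | apply: KerN_nstar].
Qed.
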